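(* Let $f_1,\dots,f_k:\mathbb{R}^N\to\mathbb{R}$ be smooth functions with common zero set $Z(f_1,\dots,f_k)\subset[-M_1,M_1]^N$, and suppose that for all $i\in\{1,\dots,k\}$ we have $|\nabla f_i|_{\mathbb{R}^N}\le M_2$ and $|\operatorname{Hess}f_i|_2\le M_3$ on $[-M_1,M_1]^N$. Let $g=(g_{ij})$ be the $k\times k$ matrix of functions $g_{ij}=\langle\nabla f_i,\nabla f_j\rangle$. If $Z(f_1,\dots,f_k)$ is non-singular, then the subdivision algorithm described in the context terminates after finitely many steps, and it yields a set $B\subset\mathbb{R}^N$ (the union of all boxes in CaseTwoBoxes) with $Z(f_1,\dots,f_k)\subset B$ such that $$|\det g(x)|>N\epsilon\cdot k!\cdot M_2^{2k-1}M_3\quad\text{for all }x\in B$$ and $$\max_{j\in\{1,\dots,k\}}|f_j(x)|>\sqrt N\,\frac{\epsilon}{2}M_2\quad\text{for all }x\in[-M_1,M_1]^N\setminus B,$$ where $\epsilon$ is the side length of the smallest box in CaseOneBoxes $\cup$ CaseTwoBoxes.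
   Context: Notation. $|\cdot|_{\mathbb{R}^N}$ is the Euclidean norm; for a matrix $A$, $|A|_2=\max_{x\ne0}|Ax|_{\mathbb{R}^N}/|x|_{\mathbb{R}^N}$. $Z(f_1,\dots,f_k)$ is non-singular if $\nabla f_1(x),\dots,\nabla f_k(x)$ are linearly independent for every $x\in Z(f_1,\dots,f_k)$. Algorithm. Boxes are closed axis-parallel cubes in $\mathbb{R}^N$. For a box $b$, subdivide$(b)$ is the set of $2^N$ boxes of half the side length whose union is $b$. Initialise NewBoxes $=\{[-M_1,M_1]^N\}$, CaseOneBoxes $=\emptyset$, CaseTwoBoxes $=\emptyset$. While NewBoxes $\ne\emptyset$: remove a box $b$ from NewBoxes; let $m$ be its midpoint and $\varepsilon$ its side length; - if $\max_{j}|f_j(m)|>\sqrt N\,\varepsilon M_2$, add $b$ to CaseOneBoxes; - else if $|\det g(m)|>2N\varepsilon\cdot k!\cdot M_2^{2k-1}M_3$, add $b$ to CaseTwoBoxes; - else add all boxes of subdivide$(b)$ to NewBoxes. The algorithm terminates when NewBoxes $=\emptyset$. *)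

(* Defs.v *)
From HB Require Import structures.
From mathcomp Require Import all_boot all_order all_algebra.
From mathcomp Require Import lra.
From mathcomp Require Import all_classical all_reals all_analysis.
Set Implicit Arguments.
Unset Strict Implicit.
Unset Printing Implicit Defensive.
Import Order.TTheory GRing.Theory Num.Theory.
Import numFieldNormedType.Exports.
Local Open Scope classical_set_scope.
Local Open Scope ring_scope.

(** * Euclidean structure of R^N

    The library norm [`|x|] of a row vector is the sup norm; it induces the
    same topology and the same differentiability as the Euclidean norm, but
    the norms occurring in the bounds are the Euclidean ones defined here. *)

Section Euclidean.
Context {R : realType} {N : nat}.
Implicit Types (u v : 'rV[R]_N) (A : 'M[R]_N).

Definition dotp u v : R := \sum_(l < N) u 0 l * v 0 l.

Definition enorm v : R := Num.sqrt (dotp v v).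

(** With row vectors, [A x] is [x *m A^T].  The supremum is a maximum, as the
    quotient is continuous and invariant under scaling. *)
Definition opnorm2 A : R :=
  sup [set enorm (x *m A^T) / enorm x | x in [set x : 'rV[R]_N | x != 0]].

Definition cube (M : R) : set 'rV[R]_N :=
  [set x | forall i, - M <= x 0 i <= M].

End Euclidean.

Section Calculus.
Context {R : realType} {N : nat}.
Implicit Types h : 'rV[R]_N -> R.

Definition partial (i : 'I_N) h : 'rV[R]_N -> R :=
  fun x => 'D_(delta_mx 0 i) h x.

Fixpoint Cn (n : nat) h : Prop :=
  if n is m.+1
  then (forall x, differentiable h x) /\ (forall i, Cn m (partial i h))
  else continuous h.

Definition smooth h : Prop := forall n, Cn n h.

Definition gradient h (x : 'rV[R]_N) : 'rV[R]_N := \row_i partial i h x.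

Definition hessian h (x : 'rV[R]_N) : 'M[R]_N :=
  \matrix_(i, j) partial i (partial j h) x.

End Calculus.

Section System.
Context {R : realType} {N k : nat}.
Variable f : 'I_k -> 'rV[R]_N -> R.

Definition zeros : set 'rV[R]_N := [set x | forall i, f i x = 0].

Definition nonsingular : Prop :=
  forall x, zeros x -> free [seq gradient (f i) x | i : 'I_k].

Definition gram (x : 'rV[R]_N) : 'M[R]_k :=
  \matrix_(i, j) dotp (gradient (f i) x) (gradient (f j) x).

(** The default value 0 is harmless: all terms are nonnegative. *)
Definition maxabs (x : 'rV[R]_N) : R := \big[Num.max/0]_(j < k) `|f j x|.

End System.

(** * Boxes *)

Section Boxes.
Context {R : realType} {N : nat}.

(** A closed axis-parallel cube, given by its midpoint and its side length. *)
Definition box : Type := ('rV[R]_N * R)%type.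

Definition midpoint (b : box) : 'rV[R]_N := b.1.
Definition side (b : box) : R := b.2.

Definition box_set (b : box) : set 'rV[R]_N :=
  [set x | forall i, `|x 0 i - midpoint b 0 i| <= side b / 2].

(** The child in the direction of the sign vector [s]: its midpoint is that of
    [b] moved by a quarter of the side length along each axis. *)
Definition child (b : box) (s : {ffun 'I_N -> bool}) : box :=
  (\row_i (midpoint b 0 i + (-1) ^+ s i * (side b / 4)), side b / 2).

Definition subdivide (b : box) : set box := range (child b).

Lemma bigcup_subdivide (b : box) :
  \bigcup_(c in subdivide b) box_set c = box_set b.
Proof.
apply/seteqP; split => x /=.
- move=> [_ [s _ <-]] xc i; move: (xc i); rewrite /child /midpoint /side /= mxE.
  move: (x 0 i) (b.1 0 i) b.2 => y m e.
  rewrite !ler_norml => /andP[].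
  by case: (s i); rewrite ?expr1 ?expr0 => h1 h2; apply/andP; split; lra.
- move=> xb; exists (child b [ffun i => x 0 i < midpoint b 0 i]); first by eexists.
  move=> i; move: (xb i); rewrite /child /midpoint /side /= mxE ffunE.
  move: (x 0 i) (b.1 0 i) b.2 => y m e.
  rewrite !ler_norml => /andP[h1 h2].
  by case: ltP => h3; rewrite ?expr1 ?expr0; apply/andP; split; lra.
Qed.

Lemma card_subdivide (b : box) :
  0 < side b -> (subdivide b #= `I_(2 ^ N))%card.
Proof.
move=> b0; have inj : injective (child b).
  move=> s t [] /rowP st; apply/ffunP => i; move/(_ i): st; rewrite !mxE.
  by move: b0; case: (s i) (t i) => [] [] //; rewrite ?expr1 ?expr0 => ? ?; lra.
apply: card_eq_trans (inj_card_eq (in2W inj)) _.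
have -> : (2 ^ N)%N = #|{ffun 'I_N -> bool}|.
  by rewrite card_ffun card_bool card_ord.
rewrite card_eq_sym; apply: card_eq_trans card_II _.
have -> : [set: 'I_#|{ffun 'I_N -> bool}|] = range enum_rank.
  by apply/seteqP; split=> // j _; exists (enum_val j) => //; exact: enum_valK.
exact: inj_card_eq (in2W enum_rank_inj).
Qed.

End Boxes.
Arguments box : clear implicits.

Lemma box_set_init (R : realType) (N : nat) (M : R) :
  box_set (0, 2 * M) = cube M :> set 'rV[R]_N.
Proof.
apply/seteqP; split=> x xM i; move: (xM i);
  rewrite /midpoint /side /= mxE subr0 mulrC mulKf ?pnatr_eq0 // ler_norml //.
Qed.

(** * The subdivision algorithm *)

Section Algorithm.
Context {R : realType} {N k : nat}.
Variables (f : 'I_k -> 'rV[R]_N -> R) (M1 M2 M3 : R).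

Record state := State {
  NewBoxes : set (box R N);
  CaseOneBoxes : set (box R N);
  CaseTwoBoxes : set (box R N) }.

Definition init : state := State [set (0, 2 * M1)] set0 set0.

Definition case_one (b : box R N) : bool :=
  maxabs f (midpoint b) > Num.sqrt N%:R * side b * M2.

Definition case_two (b : box R N) : bool :=
  `|\det (gram f (midpoint b))|
    > 2 * N%:R * side b * k`!%:R * M2 ^+ (2 * k - 1) * M3.

Definition process (b : box R N) (st : state) : state :=
  let: State new one two := st in
  if case_one b then State (new `\ b) (one `|` [set b]) two
  else if case_two b then State (new `\ b) one (two `|` [set b])
  else State (new `\ b `|` subdivide b) one two.

(** The order in which boxes are removed from [NewBoxes] is left open, so one
    iteration of the loop is a relation. *)
Definition step (st st' : state) : Prop :=
  exists2 b, NewBoxes st b & st' = process b st.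

Definition halted (st : state) : Prop := NewBoxes st = set0.

(** A run is extended to all times by staying constant once the loop has
    halted. *)
Definition run (s : nat -> state) : Prop :=
  s 0%N = init /\
  forall t, step (s t) (s t.+1) \/ (halted (s t) /\ s t.+1 = s t).

Lemma run_exists : exists s, run s.
Proof.
have /choice[next nextP] : forall st, exists st',
    step st st' \/ (halted st /\ st' = st).
  move=> st; have [e|/set0P[b nb]] := eqVneq (NewBoxes st) set0.
    by exists st; right.
  by exists (process b st); left; exists b.
by exists (fun t => iter t next init); split=> // t; exact: nextP.
Qed.

Definition output (st : state) : set 'rV[R]_N :=
  \bigcup_(b in CaseTwoBoxes st) box_set b.

Definition smallest_box (st : state) (b0 : box R N) : Prop :=
  let C := CaseOneBoxes st `|` CaseTwoBoxes st in
  C b0 /\ forall b, C b -> side b0 <= side b.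

End Algorithm.

(* Main.v *)
Require Import Defs.
From HB Require Import structures.
From mathcomp Require Import all_boot all_order all_algebra.
From mathcomp Require Import fingroup perm ring lra.
From mathcomp Require Import all_classical all_reals all_analysis.
Set Implicit Arguments.
Unset Strict Implicit.
Unset Printing Implicit Defensive.
Import Order.TTheory GRing.Theory Num.Theory.
Import numFieldNormedType.Exports.
Local Open Scope classical_set_scope.
Local Open Scope ring_scope.

(** A box of the first kind keeps [maxabs f] large on the whole box, and a box
    of the second kind keeps [\det (gram f x)] away from 0 on the whole box,
    because both functions are Lipschitz: a point of a box of side [e] is at
    distance at most [sqrt N * e / 2] from the midpoint, and the thresholds of
    the algorithm are twice the resulting variation.  For [f j] the Lipschitz
    constant is [M2] ([case_one_box]).

    For the Gram determinant the Lipschitz constant is [2 k M2 ^ (2k - 1) M3].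
    Expanding the determinant by the Leibniz formula would give [k * k!] in
    place of [k], which is too large for the threshold of the algorithm as soon
    as [sqrt N < k].
    Instead, with [V x] the matrix whose rows are the gradients at [x], one has
    [gram f x = V x (V x)^T]; the rows of [V] are replaced one at a time, and
    each change is controlled by
      [|\det (A B^T)| <= \prod_i |a_i| * \prod_i |b_i|]
    ([norm_det_mulmx_tr]), where [a_i] and [b_i] are the rows.  This inequality
    is the Cauchy-Schwarz inequality for vectors of [k]-minors followed by
    Hadamard's inequality.  Then [sqrt N <= N] and [k <= k!] give the
    variation in the form used by the algorithm ([det_gram_box]).

    The loop halts because the continuous function
    [max (maxabs f x) |\det (gram f x)|] has no zero on the compact cube: where
    all [f j] vanish, the gradients are independent and their Gram determinant
    is nonzero.  Its minimum is positive, so all boxes in the cube of side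
    less than some [d > 0] are terminal ([small_box_terminal]).  The number of
    bisections that a pending box may still undergo is thus bounded, and the sum
    over the pending boxes of [(2 ^ N + 1) ^ r], with [r] the bound for the box,
    decreases at each step, in whatever order the boxes are taken
    ([step_weight]).

    The boxes seen by the algorithm always cover the cube ([sound]), so once it
    has halted a zero lies in a box of the second kind, and a point outside
    these boxes lies in one of the first kind. *)

(** * Determinants of products [A *m B^T] *)

Lemma cauchy_schwarz (R : realFieldType) (I : finType) (a b : I -> R) :
  (\sum_i a i * b i) ^+ 2 <= (\sum_i a i ^+ 2) * (\sum_i b i ^+ 2).
Proof.
set X := \sum_i a i ^+ 2; set Y := \sum_i a i * b i; set Z := \sum_i b i ^+ 2.
have X_ge0 : 0 <= X by apply: sumr_ge0 => i _; exact: sqr_ge0.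
have : 0 <= \sum_i (X * b i - Y * a i) ^+ 2.
  by apply: sumr_ge0 => i _; exact: sqr_ge0.
have expand p q : \sum_i (p * b i - q * a i) ^+ 2
    = p ^+ 2 * Z - (p * q *+ 2) * Y + q ^+ 2 * X.
  rewrite /X /Y /Z !mulr_sumr -sumrB -big_split /=.
  by apply: eq_bigr => i _; ring.
have -> : \sum_i (X * b i - Y * a i) ^+ 2 = X * (X * Z - Y ^+ 2).
  by rewrite expand; ring.
have [X0 _|X_neq0] := eqVneq X 0; last first.
  by rewrite pmulr_rge0 ?subr_ge0 // lt0r X_neq0.
have a0 i : a i = 0.
  have /eqP := X0; rewrite psumr_eq0 => [/allP/(_ i (mem_index_enum _))|j _].
    by rewrite sqrf_eq0 => /eqP.
  exact: sqr_ge0.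
rewrite X0 mul0r /Y big1 ?expr0n // => i _.
by rewrite a0 mul0r.
Qed.

Section GramDeterminants.
Variable (R : realFieldType).

(** Leibniz formula in which each factor [\sum_l A i l * B (s i) l] is
    distributed over the choices [phi i] of [l]. *)
Lemma det_mulmx_tr k N (A B : 'M[R]_(k, N)) :
  \det (A *m B^T) = \sum_(phi : {ffun 'I_k -> 'I_N})
     (\prod_i A i (phi i)) * \det (colsub phi B).
Proof.
transitivity (\sum_(s : 'S_k) \sum_(phi : {ffun 'I_k -> 'I_N})
    (\prod_i A i (phi i)) * ((-1) ^+ s * \prod_i B (s i) (phi i))).
  apply: eq_bigr => s _.
  under eq_bigr => i _ do rewrite mxE.
  rewrite bigA_distr_bigA /= mulr_sumr; apply: eq_bigr => phi _.
  rewrite mulrCA -big_split /=; congr (_ * _); apply: eq_bigr => i _.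
  by rewrite mxE.
rewrite exchange_big /=; apply: eq_bigr => phi _.
rewrite -mulr_sumr -[\det (colsub _ _)]det_tr; congr (_ * _).
by apply: eq_bigr => s _; congr (_ * _); apply: eq_bigr => i _; rewrite !mxE.
Qed.

(** The Cauchy-Binet formula, with the sum over [k]-subsets of columns replaced
    by one over all maps: a noninjective [phi] gives two equal columns and
    contributes 0, and each subset is counted once for each of its [k!]
    orderings. *)
Lemma sum_minors k N (A B : 'M[R]_(k, N)) :
  \sum_(phi : {ffun 'I_k -> 'I_N}) \det (colsub phi A) * \det (colsub phi B)
    = k`!%:R * \det (A *m B^T).
Proof.
transitivity (\sum_(phi : {ffun 'I_k -> 'I_N}) \sum_(s : 'S_k)
    (-1) ^+ s * (\prod_i A i (phi (s i))) * \det (colsub phi B)).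
  apply: eq_bigr => phi _; rewrite mulr_suml; apply: eq_bigr => s _.
  by congr (_ * _ * _); apply: eq_bigr => i _; rewrite mxE.
rewrite exchange_big /=.
have -> : k`!%:R * \det (A *m B^T) = \sum_(s : 'S_k) \det (A *m B^T).
  by rewrite sumr_const card_Sn mulr_natl.
apply: eq_bigr => s _; rewrite det_mulmx_tr.
pose h (t : 'S_k) (phi : {ffun 'I_k -> 'I_N}) := [ffun i => phi (t i)].
(* Undo [s] in the arguments of [A]; this permutes the columns of the minor of
   [B] and produces a second sign, which cancels the first. *)
rewrite (reindex_onto (h s^-1%g) (h s)) => [|phi _]; last first.
  by apply/ffunP => i; rewrite !ffunE permKV.
apply: eq_big => [phi|phi _].
  by apply/eqP/ffunP => i; rewrite !ffunE permK.
have -> : colsub (h s^-1%g phi) B = col_perm s^-1%g (colsub phi B).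
  by apply/matrixP => i j; rewrite !mxE ffunE.
rewrite col_permE det_mulmx det_perm !odd_permV.
rewrite [\det _ * _]mulrC mulrACA -expr2 sqrr_sign mul1r; congr (_ * _).
by apply: eq_bigr => i _; rewrite ffunE permK.
Qed.

Lemma det_mulmx_tr_CS k N (A B : 'M[R]_(k, N)) :
  \det (A *m B^T) ^+ 2 <= \det (A *m A^T) * \det (B *m B^T).
Proof.
have k2_gt0 : 0 < k`!%:R ^+ 2 :> R by rewrite exprn_gt0 // ltr0n fact_gt0.
rewrite -(ler_pM2l k2_gt0) -exprMn [X in _ <= X * _]expr2 mulrACA -!sum_minors.
exact: cauchy_schwarz.
Qed.

Lemma det_gram_ge0 k N (A : 'M[R]_(k, N)) : 0 <= \det (A *m A^T).
Proof.
have k_gt0 : 0 < k`!%:R :> R by rewrite ltr0n fact_gt0.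
rewrite -(pmulr_rge0 _ k_gt0) -sum_minors sumr_ge0 // => phi _.
by rewrite -expr2 sqr_ge0.
Qed.

(** Hadamard's inequality for Gram matrices, by induction on the number of rows:
    unless the first row is 0, subtracting from each other row its projection on
    the first one leaves the determinant unchanged, makes the Gram matrix block
    diagonal, and does not lengthen any row. *)
Lemma hadamard k N (A : 'M[R]_(k, N)) :
  \det (A *m A^T) <= \prod_i \sum_l A i l ^+ 2.
Proof.
elim: k A => [|k IH] A; first by rewrite det_mx00 big_ord0.
move: A; rewrite -[k.+1]add1n => A; rewrite -(vsubmxK A).
move: (usubmx _) (dsubmx _) => a B.
rewrite (@big_split_ord R 1 *%R 1 k) /= big_ord1.
have -> : \sum_l col_mx a B (lshift k ord0) l ^+ 2 = \sum_l a 0 l ^+ 2.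
  by apply: eq_bigr => l _; rewrite col_mxEu.
have -> : \prod_i \sum_l col_mx a B (rshift 1 i) l ^+ 2
    = \prod_i \sum_l B i l ^+ 2.
  by apply: eq_bigr => i _; apply: eq_bigr => l _; rewrite col_mxEd.
set q := \sum_l a _ l ^+ 2.
have q_ge0 : 0 <= q by apply: sumr_ge0 => l _; exact: sqr_ge0.
have aaE : a *m a^T = q%:M.
  apply/matrixP => i j; rewrite !ord1 !mxE eqxx mulr1n; apply: eq_bigr => l _.
  by rewrite mxE expr2.
have [q0|q_neq0] := eqVneq q 0.
  have a0 : a = 0.
    apply/rowP => l; rewrite mxE.
    move/eqP: q0; rewrite psumr_eq0 => [/allP/(_ l (mem_index_enum _))|j _].
      by rewrite sqrf_eq0 => /eqP.
    exact: sqr_ge0.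
  rewrite q0 mul0r a0 tr_col_mx trmx0 mul_col_row !(mul0mx, mulmx0).
  by rewrite (@det_lblock _ 1 k) det0 mul0r.
(* [c] collects the coefficients of the projections of the rows of [B] on [a],
   [P] the remainders, and [E] the row operation that produces them. *)
pose c := q^-1 *: (B *m a^T).
pose P := B - c *m a.
pose E : 'M[R]_(1 + k) := block_mx 1%:M 0 (- c) 1%:M.
have EA : E *m col_mx a B = col_mx a P.
  by rewrite mul_block_col !mul1mx mul0mx addr0 mulNmx addrC.
have aP : P *m a^T = 0.
  by rewrite mulmxBl -mulmxA aaE mul_mx_scalar /c scalerA divff // scale1r subrr.
have detE : \det E = 1 by rewrite det_lblock !det1 mulr1.
have -> : \det (col_mx a B *m (col_mx a B)^T) = q * \det (P *m P^T).
  transitivity (\det (E *m (col_mx a B *m (col_mx a B)^T) *m E^T)).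
    by rewrite !det_mulmx det_tr detE mul1r mulr1.
  rewrite mulmxA -mulmxA -trmx_mul EA tr_col_mx mul_col_row aP.
  by rewrite -[a *m P^T]trmxK trmx_mul trmxK aP trmx0 det_lblock aaE det_scalar1.
apply: ler_wpM2l => //; apply: (le_trans (IH P)).
apply: ler_prod => i _; apply/andP; split.
  by apply: sumr_ge0 => l _; exact: sqr_ge0.
pose d := \sum_l B i l * a 0 l.
have cE : c i 0 = q^-1 * d.
  by rewrite mxE mxE; congr (_ * _); apply: eq_bigr => l _; rewrite mxE.
have -> : \sum_l P i l ^+ 2 = \sum_l B i l ^+ 2 - q^-1 * d ^+ 2.
  transitivity (\sum_l B i l ^+ 2 - (c i 0 *+ 2) * d + c i 0 ^+ 2 * q).
    rewrite /d /q !mulr_sumr -sumrB -big_split /=; apply: eq_bigr => l _.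
    have -> : P i l = B i l - c i 0 * a 0 l.
      by rewrite mxE; congr (_ + _); rewrite mxE [in LHS]mxE big_ord1.
    by ring.
  by rewrite cE; field.
by rewrite gerBl mulr_ge0 ?sqr_ge0 // invr_ge0.
Qed.

Lemma norm_det_mulmx_tr k N (A B : 'M[R]_(k, N)) (p q : 'I_k -> R) :
    (forall i, 0 <= p i) -> (forall i, 0 <= q i) ->
    (forall i, \sum_l A i l ^+ 2 <= p i ^+ 2) ->
    (forall i, \sum_l B i l ^+ 2 <= q i ^+ 2) ->
  `|\det (A *m B^T)| <= (\prod_i p i) * (\prod_i q i).
Proof.
move=> p0 q0 Ap Bq.
have bound (C : 'M[R]_(k, N)) r : (forall i, \sum_l C i l ^+ 2 <= r i ^+ 2) ->
    \det (C *m C^T) <= (\prod_i r i) ^+ 2.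
  move=> Cr; apply: (le_trans (hadamard C)); rewrite -prodrXl.
  apply: ler_prod => i _; rewrite Cr andbT.
  by apply: sumr_ge0 => l _; exact: sqr_ge0.
rewrite -(@ler_pXn2r _ 2) ?nnegrE ?mulr_ge0 ?prodr_ge0 //.
rewrite real_normK ?num_real // exprMn.
apply: (le_trans (det_mulmx_tr_CS A B)).
by apply: ler_pM; rewrite ?det_gram_ge0 ?bound.
Qed.

Section Perturbation.
Variables (k N : nat) (M D : R).
Hypotheses (M_ge0 : 0 <= M) (D_ge0 : 0 <= D).

Let bounded (C : 'M[R]_(k, N)) := forall i, \sum_l C i l ^+ 2 <= M ^+ 2.

(** The rows of [V] are changed into those of [W] one by one.  By
    multilinearity each change of the determinant is again of the form
    [\det (Y *m X^T)], where one row of [Y] is a row of [W - V]. *)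
Lemma det_mulmx_tr_lip (V W X : 'M[R]_(k, N)) :
    bounded V -> bounded W -> bounded X ->
    (forall i, \sum_l (V i l - W i l) ^+ 2 <= D ^+ 2) ->
  `|\det (V *m X^T) - \det (W *m X^T)| <= k%:R * M ^+ (2 * k - 1) * D.
Proof.
move=> Vb Wb Xb VWb.
pose mix j : 'M[R]_(k, N) := \matrix_(i, l) if (i < j)%N then W i l else V i l.
have -> : V = mix 0%N by apply/matrixP => i l; rewrite mxE.
have -> : W = mix k by apply/matrixP => i l; rewrite mxE ltn_ord.
(* [mix j] has its first [j] rows taken from [W] and the others from [V]. *)
rewrite -opprB normrN -(telescope_sumr (fun j => \det (mix j *m X^T))) //.
rewrite big_mkord; apply: (le_trans (ler_norm_sum _ _ _)).
rewrite -mulrA mulr_natl -[k in _ *+ k]card_ord -sumr_const.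
apply: ler_sum => j _.
pose Y : 'M[R]_(k, N) := \matrix_(i, l)
  if i == j then W i l - V i l else mix j i l.
have -> : \det (mix j.+1 *m X^T) - \det (mix j *m X^T) = \det (Y *m X^T).
  rewrite (@determinant_multilinear _ _ (Y *m X^T) (mix j.+1 *m X^T)
    (mix j *m X^T) j 1 (-1)) ?mul1r ?mulN1r //.
  - rewrite !row_mul scale1r scaleN1r -mulmxBl; congr (_ *m _).
    by apply/rowP => l; rewrite !mxE eqxx ltnS leqnn ltnn.
  - apply/matrixP => i l; rewrite !mxE; apply: eq_bigr => m _; rewrite !mxE.
    by rewrite eq_sym (negPf (neq_lift _ _)) ltnS leq_eqVlt val_eqE
      eq_sym (negPf (neq_lift _ _)).
  - apply/matrixP => i l; rewrite !mxE; apply: eq_bigr => m _; rewrite !mxE.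
    by rewrite eq_sym (negPf (neq_lift _ _)).
pose p i := if i == j then D else M.
have -> : M ^+ (2 * k - 1) * D = (\prod_i p i) * \prod_(i < k) M.
  rewrite prodr_const card_ord (bigD1 j) //= /p eqxx.
  under eq_bigr => i ij do rewrite (negPf ij).
  rewrite prodr_const cardC1 card_ord mulrC -mulrA -exprD.
  by rewrite mul2n -addnn -subn1 addnBAC // (leq_ltn_trans _ (ltn_ord j)).
apply: norm_det_mulmx_tr => // i; rewrite /p.
- by case: eqP.
- case: eqP => [->|/eqP ij].
    apply: le_trans (VWb j); rewrite le_eqVlt; apply/orP; left; apply/eqP.
    by apply: eq_bigr => l _; rewrite mxE eqxx -sqrrN opprB.
  under eq_bigr => l _ do rewrite mxE (negPf ij) mxE.
  by case: ltnP => _.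
Qed.

Lemma det_gram_lip (V W : 'M[R]_(k, N)) :
    bounded V -> bounded W ->
    (forall i, \sum_l (V i l - W i l) ^+ 2 <= D ^+ 2) ->
  `|\det (V *m V^T) - \det (W *m W^T)| <= 2 * k%:R * M ^+ (2 * k - 1) * D.
Proof.
move=> Vb Wb VWb.
have WV : \det (W *m V^T) = \det (V *m W^T).
  by rewrite -det_tr trmx_mul trmxK.
rewrite -[X in `|X - _|](subrK (\det (W *m V^T))) -addrA [X in _ + (X - _)]WV.
apply: (le_trans (ler_normD _ _)); rewrite -!mulrA mulr2n mulrDl !mul1r !mulrA.
by apply: lerD; apply: det_mulmx_tr_lip.
Qed.

End Perturbation.
End GramDeterminants.

(** * Euclidean norm, operator norm and boxes *)

Section EuclideanLemmas.
Context {R : realType} {N : nat}.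
Implicit Types (u v x : 'rV[R]_N) (A : 'M[R]_N).

Lemma dotp_ge0 v : 0 <= dotp v v.
Proof. by apply: sumr_ge0 => l _; rewrite -expr2 sqr_ge0. Qed.

Lemma enorm_ge0 v : 0 <= enorm v. Proof. exact: sqrtr_ge0. Qed.

Lemma sqr_enorm v : enorm v ^+ 2 = dotp v v.
Proof. by rewrite sqr_sqrtr ?dotp_ge0. Qed.

Lemma sqr_enormE v : enorm v ^+ 2 = \sum_l v 0 l ^+ 2.
Proof. by rewrite sqr_enorm; apply: eq_bigr => l _; rewrite expr2. Qed.

Lemma enorm_leP v (c : R) : 0 <= c -> (enorm v <= c) = (dotp v v <= c ^+ 2).
Proof.
by move=> c0; rewrite -sqr_enorm ler_pXn2r ?nnegrE ?enorm_ge0.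
Qed.

Lemma dotp_le u v : `|dotp u v| <= enorm u * enorm v.
Proof.
rewrite -(@ler_pXn2r _ 2) ?nnegrE ?mulr_ge0 ?enorm_ge0 //.
rewrite real_normK ?num_real // exprMn !sqr_enormE.
exact: cauchy_schwarz.
Qed.

Lemma dotp_eq0 v : dotp v v = 0 -> v = 0.
Proof.
move/eqP; rewrite psumr_eq0 => [/allP v0|l _]; last by rewrite -expr2 sqr_ge0.
apply/rowP => l; rewrite mxE; have := v0 l (mem_index_enum _).
by rewrite -expr2 sqrf_eq0 => /eqP.
Qed.

Lemma enorm_gt0 v : v != 0 -> 0 < enorm v.
Proof.
move=> v0; rewrite lt0r enorm_ge0 andbT; apply: contra v0 => /eqP v0.
by apply/eqP/dotp_eq0; rewrite -sqr_enorm v0 expr0n.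
Qed.

(** The Frobenius norm bounds the quotients in the definition of [opnorm2], so
    that their supremum is indeed an upper bound. *)
Lemma opnorm2_le x A : enorm (x *m A^T) <= opnorm2 A * enorm x.
Proof.
have [->|x0] := eqVneq x 0.
  rewrite mul0mx (_ : enorm 0 = 0) ?mulr0 // /enorm /dotp big1 ?sqrtr0 // => l _.
  by rewrite mxE mul0r.
rewrite -ler_pdivrMr ?enorm_gt0 //; apply: ub_le_sup; last by exists x.
pose C := \sum_i \sum_j A i j ^+ 2.
have C_ge0 : 0 <= C by do 2 (apply: sumr_ge0 => ? _); exact: sqr_ge0.
exists (Num.sqrt C) => _ [y /= y0 <-].
rewrite ler_pdivrMr ?enorm_gt0 // enorm_leP ?mulr_ge0 ?sqrtr_ge0 // exprMn sqr_sqrtr //.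
rewrite mulr_suml; apply: ler_sum => i _.
rewrite -expr2 sqr_enormE mulrC.
rewrite (_ : (y *m A^T) 0 i = \sum_j y 0 j * A i j); first exact: cauchy_schwarz.
by rewrite mxE; apply: eq_bigr => j _; rewrite mxE.
Qed.

Lemma opnorm2_ge0 A : 0 <= opnorm2 A.
Proof.
have [[x /= x0]|noneq0] := pselect ([set x : 'rV[R]_N | x != 0] !=set0).
  have := le_trans (enorm_ge0 _) (opnorm2_le x A).
  by rewrite pmulr_lge0 ?enorm_gt0.
rewrite /opnorm2 (_ : [set x : 'rV[R]_N | x != 0] = set0) ?image_set0 ?sup0 //.
by apply: contrapT => /eqP/set0P.
Qed.

Lemma cube_segment (M t : R) x v : 0 <= t <= 1 ->
  cube M x -> cube M (x + v) -> cube M (x + t *: v).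
Proof.
move=> /andP[t0 t1] xM xvM i; have := xM i; have := xvM i; rewrite !mxE.
by move: (x 0 i) (v 0 i) => a b /andP[? ?] /andP[? ?]; apply/andP; split; nra.
Qed.

Lemma box_enorm_le (b : box R N) x : 0 <= side b -> box_set b x ->
  enorm (x - midpoint b) <= Num.sqrt N%:R * (side b / 2).
Proof.
move=> b0 xb; have b20 : 0 <= side b / 2 by rewrite divr_ge0.
rewrite enorm_leP ?mulr_ge0 ?sqrtr_ge0 //.
rewrite exprMn sqr_sqrtr ?ler0n // -[N in N%:R]card_ord mulr_natl -sumr_const.
apply: ler_sum => i _; rewrite -expr2 -[leLHS]real_normK ?num_real //.
by rewrite ler_pXn2r ?nnegrE // !mxE; exact: xb.
Qed.

End EuclideanLemmas.

(** * Mean value inequalities *)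

Section CalculusLemmas.
Context {R : realType} {N : nat}.
Implicit Types (h : 'rV[R]_N -> R) (x v : 'rV[R]_N).

Lemma smooth_differentiable h x : smooth h -> differentiable h x.
Proof. by move=> sh; case: (sh 1%N) => dh _; exact: dh. Qed.

Lemma smooth_continuous h : smooth h -> continuous h.
Proof. by move=> sh; exact: (sh 0%N). Qed.

Lemma smooth_partial i h : smooth h -> smooth (partial i h).
Proof. by move=> sh n; case: (sh n.+1) => _ dh; exact: dh. Qed.

Lemma deriveE_gradient h x v : differentiable h x ->
  'D_v h x = dotp (gradient h x) v.
Proof.
move=> dh; rewrite deriveE // [in LHS](row_sum_delta v) linear_sum.
apply: eq_bigr => l _; rewrite linearZ /= mulrC mxE /partial deriveE //.
Qed.

(** The mean value theorem for [t |-> h (x + t *: v)], whose difference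
    quotients are the directional ones of [h]. *)
Lemma mvt_line h x v : (forall y, differentiable h y) ->
  exists2 t, 0 <= t <= 1 & h (x + v) - h x = 'D_v h (x + t *: v).
Proof.
move=> dh; pose p (t : R) := h (x + t *: v).
have pq t : (fun s => s^-1 *: ((p \o shift t) (s *: 1) - p t)) =
    (fun s => s^-1 *: ((h \o shift (x + t *: v)) (s *: v) - h (x + t *: v))).
  apply/funext => s; rewrite /p /= [s *: 1]mulr1; congr (_ *: (h _ - _)).
  by rewrite scalerDl addrCA.
have dp (t : R) : is_derive t (1 : R) p ('D_v h (x + t *: v)).
  split; last by rewrite /derive pq.
  by rewrite /derivable pq; exact: diff_derivable.
have cp : {within `[0, 1], continuous p}.
  apply: derivable_within_continuous => t _; exact: ex_derive.
have [t t01] := MVT_segment ler01 (fun t _ => dp t) cp.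
rewrite subr0 mulr1 /p scale1r scale0r addr0 => ->.
by exists t => //; move: t01; rewrite in_itv.
Qed.

Lemma gradient_lip h (M L : R) x y : (forall z, differentiable h z) ->
    (forall z, cube M z -> enorm (gradient h z) <= L) ->
    cube M x -> cube M y ->
  `|h y - h x| <= L * enorm (y - x).
Proof.
move=> dh hL xM yM; have [t t01] := mvt_line x (y - x) dh.
rewrite addrCA subrr addr0 deriveE_gradient // => ->.
apply: (le_trans (dotp_le _ _)); apply: ler_wpM2r; first exact: enorm_ge0.
by apply: hL; apply: cube_segment => //; rewrite addrCA subrr addr0.
Qed.

(** For the vector-valued gradient, the mean value inequality is applied to its
    scalar product [G] with the fixed vector [e], the increment of the gradient:
    then [G y - G x = |e| ^ 2], and the gradient of [G] is the Hessian applied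
    to [e]. *)
Lemma hessian_lip h (M L : R) x y : smooth h ->
    (forall z, cube M z -> opnorm2 (hessian h z) <= L) ->
    cube M x -> cube M y ->
  enorm (gradient h y - gradient h x) <= L * enorm (y - x).
Proof.
move=> sh hL xM yM; set e := gradient h y - gradient h x.
pose G : 'rV[R]_N -> R := \sum_(l < N) (e 0 l *: partial l h).
have dpar l z : differentiable (partial l h) z.
  by apply: smooth_differentiable; exact: smooth_partial.
have dG z : differentiable G z.
  rewrite /G; apply: differentiable_sum => l; apply: differentiableZ; exact: dpar.
have GE z : G z = dotp e (gradient h z).
  by rewrite /G fct_sumE; apply: eq_bigr => l _; rewrite [gradient h z _ _]mxE.
have gradG z : gradient G z = e *m (hessian h z)^T.
  apply/rowP => i; rewrite !mxE /partial derive_sum => [|l]; last first.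
    by apply: derivableZ; exact: diff_derivable.
  apply: eq_bigr => l _; rewrite deriveZ ?mxE //; exact: diff_derivable.
have : enorm e ^+ 2 <= (L * enorm e) * enorm (y - x).
  have -> : enorm e ^+ 2 = G y - G x.
    rewrite sqr_enorm !GE -sumrB; apply: eq_bigr => l _.
    by rewrite -mulrBr [in LHS]/e !mxE.
  apply: (le_trans (ler_norm _)); apply: gradient_lip xM yM => // z zM.
  rewrite gradG; apply: (le_trans (opnorm2_le _ _)).
  by apply: ler_wpM2r (hL _ zM); exact: enorm_ge0.
have [->|e0] := eqVneq (enorm e) 0; last first.
  by rewrite mulrAC expr2 ler_pM2r // lt0r e0 enorm_ge0.
move=> _; apply: mulr_ge0; last exact: enorm_ge0.
exact: le_trans (opnorm2_ge0 _) (hL x xM).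
Qed.

End CalculusLemmas.

(** * The system on the cube *)

Lemma continuous_mul (R : realType) (T : topologicalType) (a b : T -> R) :
  continuous a -> continuous b -> continuous (fun x => a x * b x).
Proof. by move=> ca cb x; exact: (cvgM (ca x) (cb x)). Qed.

Lemma continuous_normr (R : realType) (T : topologicalType) (a : T -> R) :
  continuous a -> continuous (fun x => `|a x|).
Proof. by move=> ca x; exact: (cvg_norm (ca x)). Qed.

Section SystemLemmas.
Context {R : realType} {N k : nat}.
Variable f : 'I_k -> 'rV[R]_N -> R.

Definition gradmx (x : 'rV[R]_N) : 'M[R]_(k, N) :=
  \matrix_(i, l) gradient (f i) x 0 l.

Lemma gramE x : gram f x = gradmx x *m (gradmx x)^T.
Proof.
by apply/matrixP => i j; rewrite !mxE; apply: eq_bigr => l _; rewrite !mxE.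
Qed.

(** If [v] is in the kernel of the Gram matrix, then the combination of the
    gradients with coefficients [v] has norm 0. *)
Lemma det_gram_neq0 x : nonsingular f -> zeros f x -> \det (gram f x) != 0.
Proof.
move=> fn /fn fx; apply/negP => /det0P[v v0 vG].
have Gw : v *m gradmx x = 0.
  apply: dotp_eq0.
  transitivity ((v *m gram f x *m v^T) 0 0); last by rewrite vG mul0mx mxE.
  rewrite gramE -!mulmxA -trmx_mul mulmxA mxE.
  by apply: eq_bigr => l _; rewrite !mxE.
have : free [tuple gradient (f i) x | i < k] by exact: fx.
move/freeP => /(_ (fun i => v 0 i)) v_eq0; case/eqP: v0.
apply/rowP => i; rewrite mxE; apply: v_eq0; rewrite -[RHS]Gw.
rewrite mulmx_sum_row; apply: eq_bigr => j _; congr (_ *: _).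
by rewrite -tnth_nth tnth_mktuple; apply/rowP => l; rewrite !mxE.
Qed.

Lemma maxabs_ge0 x : 0 <= maxabs f x.
Proof.
rewrite /maxabs; elim/big_ind: _ => // a b a0 b0.
by rewrite le_max a0.
Qed.

Lemma maxabs_gtP x (c : R) : 0 <= c ->
  reflect (exists j, c < `|f j x|) (c < maxabs f x).
Proof.
move=> c0; apply: (iffP (bigmax_gtP _ _ _ _)) => [[|[j _ cj]]|[j cj]].
- by rewrite ltNge c0.
- by exists j.
- by right; exists j.
Qed.

Lemma zeros_maxabs x : zeros f x <-> maxabs f x = 0.
Proof.
split=> [fx|fx j].
  by rewrite /maxabs; elim/big_ind: _ => // [a b -> ->|j _]; rewrite ?maxxx // fx normr0.
apply/normr0_eq0/le_anti; rewrite normr_ge0 andbT -fx; exact: le_bigmax.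
Qed.

Section Continuity.
Hypothesis f_smooth : forall i, smooth (f i).

Lemma maxabs_continuous : continuous (maxabs f).
Proof.
apply: continuous_big; first exact: max_continuous.
by move=> j _; apply: continuous_normr; exact: smooth_continuous.
Qed.

Lemma det_gram_continuous : continuous (fun x => \det (gram f x)).
Proof.
rewrite /determinant; apply: continuous_big; first exact: add_continuous.
move=> s _; have entry i j : continuous (fun x => gram f x i j).
  under eq_fun => x do rewrite mxE.
  apply: continuous_big; first exact: add_continuous.
  move=> l _; under eq_fun => y do rewrite !mxE.
  by apply: continuous_mul; apply: smooth_continuous; exact: smooth_partial.
have prod_cont : continuous (fun x => \prod_i gram f x i (s i)).
  by apply: continuous_big; [exact: mul_continuous|move=> i _; exact: entry].
by apply: continuous_mul => //; exact: cst_continuous.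
Qed.

End Continuity.
End SystemLemmas.

Lemma cube_compact (R : realType) N (M : R) : compact (cube M : set 'rV[R]_N).
Proof.
have -> : cube M = [set v : 'rV[R]_N | forall i, `[- M, M]%classic (v ord0 i)].
  by apply/seteqP; split => v vM i; have := vM i; rewrite /= in_itv.
by apply: (@rV_compact R N (fun=> `[- M, M]%classic)) => _; exact: segment_compact.
Qed.

(** * Estimates on a box *)

Section Estimates.
Context {R : realType} {N k : nat}.
Variables (f : 'I_k -> 'rV[R]_N -> R) (M1 M2 M3 : R).
Hypotheses (k_gt0 : (0 < k)%N) (M1_ge0 : 0 <= M1)
    (f_smooth : forall i, smooth (f i))
    (grad_le : forall i x, cube M1 x -> enorm (gradient (f i) x) <= M2)
    (hess_le : forall i x, cube M1 x -> opnorm2 (hessian (f i) x) <= M3).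

Lemma cube0 : cube M1 (0 : 'rV[R]_N).
Proof. by move=> i; rewrite mxE oppr_le0 M1_ge0. Qed.

Lemma gradient_bound_ge0 : 0 <= M2.
Proof. exact: le_trans (enorm_ge0 _) (grad_le (Ordinal k_gt0) cube0). Qed.

Lemma hessian_bound_ge0 : 0 <= M3.
Proof. exact: le_trans (opnorm2_ge0 _) (hess_le (Ordinal k_gt0) cube0). Qed.

Lemma box_midpoint (b : box R N) : 0 <= side b -> box_set b (midpoint b).
Proof. by move=> b0 i; rewrite subrr normr0 divr_ge0. Qed.

Variable b : box R N.
Hypotheses (side_ge0 : 0 <= side b) (b_cube : box_set b `<=` cube M1).

Let m_cube : cube M1 (midpoint b).
Proof. exact/b_cube/box_midpoint. Qed.

Lemma case_one_box x : case_one f M2 b -> box_set b x ->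
  Num.sqrt N%:R * (side b / 2) * M2 < maxabs f x.
Proof.
have M2_ge0 := gradient_bound_ge0.
move=> + xb; have c_ge0 : 0 <= Num.sqrt N%:R * side b * M2.
  by rewrite !mulr_ge0 ?sqrtr_ge0.
move=> /(maxabs_gtP _ _ c_ge0)[j fj]; apply/maxabs_gtP.
  by rewrite !mulr_ge0 ?sqrtr_ge0 // divr_ge0.
exists j.
have := @gradient_lip _ _ (f j) M1 M2 (midpoint b) x
  (fun z => smooth_differentiable z (f_smooth j)) (grad_le j) m_cube (b_cube xb).
have := ler_wpM2l M2_ge0 (box_enorm_le side_ge0 xb).
have := ler_distD (f j x) (f j (midpoint b)) 0; rewrite !subr0 distrC.
move: fj; set a := Num.sqrt _; set e := enorm _; set s := side b.
have -> : a * s * M2 = M2 * (a * (s / 2)) + a * (s / 2) * M2 by field.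
lra.
Qed.

Let sqrt_le : Num.sqrt N%:R <= N%:R :> R.
Proof.
rewrite -[leRHS]ger0_norm // -sqrtr_sqr ler_wsqrtr // -natrX ler_nat.
by case: (N) => // n; rewrite expnS leq_pmulr ?expn_gt0.
Qed.

Lemma det_gram_box x : box_set b x ->
  `|\det (gram f x) - \det (gram f (midpoint b))|
    <= N%:R * side b * k`!%:R * M2 ^+ (2 * k - 1) * M3.
Proof.
have M2_ge0 := gradient_bound_ge0; have M3_ge0 := hessian_bound_ge0.
move=> xb; have xM := b_cube xb; rewrite !gramE.
pose D := M3 * (Num.sqrt N%:R * (side b / 2)).
have D_ge0 : 0 <= D by rewrite !mulr_ge0 ?sqrtr_ge0 ?divr_ge0.
have rowE z i : \sum_l gradmx f z i l ^+ 2 = enorm (gradient (f i) z) ^+ 2.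
  by rewrite sqr_enormE; apply: eq_bigr => l _; rewrite mxE.
have rows z (zM : cube M1 z) i : \sum_l gradmx f z i l ^+ 2 <= M2 ^+ 2.
  by rewrite rowE ler_pXn2r ?nnegrE ?enorm_ge0 // grad_le.
have diff i : \sum_l (gradmx f x i l - gradmx f (midpoint b) i l) ^+ 2 <= D ^+ 2.
  rewrite (_ : \sum_l _ =
      enorm (gradient (f i) x - gradient (f i) (midpoint b)) ^+ 2); last first.
    by rewrite sqr_enormE; apply: eq_bigr => l _; rewrite !mxE.
  rewrite ler_pXn2r ?nnegrE ?enorm_ge0 //.
  apply: le_trans (hessian_lip (f_smooth i) (hess_le i) m_cube xM) _.
  by apply: ler_wpM2l => //; exact: box_enorm_le.
apply: le_trans (det_gram_lip M2_ge0 D_ge0 (rows _ xM) (rows _ m_cube) diff) _.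
have -> : 2 * k%:R * M2 ^+ (2 * k - 1) * D
    = (Num.sqrt N%:R * k%:R) * (side b * M2 ^+ (2 * k - 1) * M3).
  by rewrite /D; field.
have -> : N%:R * side b * k`!%:R * M2 ^+ (2 * k - 1) * M3
    = (N%:R * k`!%:R) * (side b * M2 ^+ (2 * k - 1) * M3).
  by ring.
apply: ler_wpM2r; first by rewrite !mulr_ge0 ?exprn_ge0.
by apply: ler_pM; rewrite ?sqrtr_ge0 // ler_nat fact_geq.
Qed.

Lemma case_two_box x : case_two f M2 M3 b -> box_set b x ->
  N%:R * side b * k`!%:R * M2 ^+ (2 * k - 1) * M3 < `|\det (gram f x)|.
Proof.
move=> b2 /det_gram_box; move: b2; rewrite /case_two -!(mulrA 2).
set g := \det (gram f x); set h := \det _; set c := N%:R * _.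
have := ler_distD g h 0; rewrite !subr0 distrC.
lra.
Qed.

End Estimates.

Section SmallBoxes.
Context {R : realType} {N k : nat}.
Variables (f : 'I_k -> 'rV[R]_N -> R) (M1 M2 M3 : R).
Hypotheses (M1_ge0 : 0 <= M1)
    (f_smooth : forall i, smooth (f i))
    (M2_ge0 : 0 <= M2) (M3_ge0 : 0 <= M3)
    (f_nonsingular : nonsingular f).

Lemma small_box_terminal : exists2 d : R, 0 < d & forall b : box R N,
  0 <= side b -> cube M1 (midpoint b) -> side b < d ->
  case_one f M2 b || case_two f M2 M3 b.
Proof.
pose F x := Num.max (maxabs f x) `|\det (gram f x)|.
have F_cont : continuous F.
  apply: max_fun_continuous; first exact: maxabs_continuous.
  by apply: continuous_normr; exact: det_gram_continuous.
have [x0 _ x0_min] : exists2 c : 'rV[R]_N, c \in cube M1 &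
    forall t : 'rV[R]_N, t \in cube M1 -> F c <= F t.
  apply: EVT_min_rV (@cube_compact _ _ _) _; first by exists 0; exact: cube0.
  exact: continuous_subspaceT.
have F_gt0 : 0 < F x0.
  rewrite lt_max; have [fx|] := eqVneq (maxabs f x0) 0.
    by rewrite normr_gt0 det_gram_neq0 ?orbT //; exact/zeros_maxabs.
  by rewrite lt0r maxabs_ge0 => ->.
pose c1 := Num.sqrt N%:R * M2.
pose c2 := 2 * N%:R * k`!%:R * M2 ^+ (2 * k - 1) * M3.
have c1_ge0 : 0 <= c1 by rewrite mulr_ge0 ?sqrtr_ge0.
have c2_ge0 : 0 <= c2 by rewrite !mulr_ge0 ?exprn_ge0.
have K_gt0 : 0 < c1 + c2 + 1 by lra.
exists (F x0 / (c1 + c2 + 1)); first by rewrite divr_gt0.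
move=> b b0 bM; rewrite ltr_pdivlMr // => small.
have := x0_min (midpoint b) (mem_set bM); rewrite {2}/F le_max => Fm.
apply/orP; case/orP: Fm => [Fm|Fm]; [left|right]; apply: lt_le_trans Fm.
  rewrite -mulrA [side b * _]mulrC mulrA -/c1; nra.
rewrite (_ : 2 * _ * _ * _ * _ * _ = c2 * side b); last by rewrite /c2; ring.
nra.
Qed.

End SmallBoxes.

(** * The subdivision algorithm *)

Section Termination.
Context {R : realType} {N k : nat}.
Variables (f : 'I_k -> 'rV[R]_N -> R) (M1 M2 M3 : R).

Definition terminal (b : box R N) := case_one f M2 b || case_two f M2 M3 b.

Lemma child_box (b : box R N) t : 0 <= side b ->
  0 <= side (child b t) /\ box_set (child b t) `<=` box_set b.
Proof.
move=> b0; split; first by rewrite divr_ge0.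
by move=> x xb; rewrite -bigcup_subdivide; exists (child b t) => //; exists t.
Qed.

(** All boxes reached from [b] are terminal after at most [r] bisections. *)
Fixpoint resolved (r : nat) (b : box R N) : Prop :=
  terminal b \/ if r is q.+1 then forall t, resolved q (child b t) else False.

Lemma resolvedP (d : R) :
    (forall b : box R N, 0 <= side b -> cube M1 (midpoint b) -> side b < d ->
      terminal b) ->
  forall r (b : box R N), 0 <= side b -> box_set b `<=` cube M1 ->
    side b < d * 2 ^+ r -> resolved r b.
Proof.
move=> small; elim=> [|r IH] b b0 bM bd.
  by left; apply: small => //; [exact/bM/box_midpoint|rewrite expr0 mulr1 in bd].
right=> t; have [c0 cb] := child_box t b0; apply: IH => //.
  exact: subset_trans cb bM.
by rewrite /side /= ltr_pdivrMr // -mulrA -exprSr.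
Qed.

(** Pending boxes are listed with a bound on the number of bisections they can
    still undergo.  The base exceeds the number of children, so a box outweighs
    its children together. *)
Definition weight (l : seq (box R N * nat)) : nat :=
  \sum_(p <- l) (2 ^ N).+1 ^ p.2.

(** The list may also hold boxes that are no longer pending, and one box with
    several bounds: this only makes the weight larger. *)
Definition tracks (l : seq (box R N * nat)) (st : state) : Prop :=
  (forall b, NewBoxes st b -> exists r, (b, r) \in l) /\
  (forall p, p \in l -> resolved p.2 p.1).

Lemma weight_filter (b : box R N) r l : (b, r) \in l ->
  (weight [seq p <- l | p.1 != b] + (2 ^ N).+1 ^ r <= weight l)%N.
Proof.
move=> bl; rewrite /weight big_filter [leqRHS](bigID (fun p => p.1 != b)) /=.
rewrite leq_add2l big_mkcond (big_rem _ bl) /= eqxx leq_addr //.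
Qed.

Lemma process_terminal (b : box R N) st : terminal b ->
  NewBoxes (process f M2 M3 b st) = NewBoxes st `\ b.
Proof.
by case: st => new one two; rewrite /process /terminal; case: ifP => // _ /= ->.
Qed.

Lemma process_split (b : box R N) st : ~~ terminal b ->
  NewBoxes (process f M2 M3 b st) = NewBoxes st `\ b `|` subdivide b.
Proof.
case: st => new one two; rewrite /process /terminal negb_or.
by case/andP => /negPf-> /negPf->.
Qed.

(** All entries of the processed box are dropped, and its children, if any, are
    entered with a bound smaller by one. *)
Lemma step_weight l st st' : tracks l st -> step f M2 M3 st st' ->
  exists2 l', tracks l' st' & (weight l' < weight l)%N.
Proof.
move=> [lnew lres] [b bnew ->]; have [r brl] := lnew b bnew.
have := lres _ brl; have := weight_filter brl.
set l0 := [seq p <- l | p.1 != b] => wl /= bres.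
have l0new c : NewBoxes st c -> c <> b -> exists q, (c, q) \in l0.
  by move=> /lnew[q cq] /eqP cb; exists q; rewrite mem_filter cb.
have l0res p : p \in l0 -> resolved p.2 p.1.
  by rewrite mem_filter => /andP[_ /lres].
have [tb|tb] := boolP (terminal b).
  exists l0; last first.
    by apply: leq_trans wl; rewrite -[ltnLHS]addn0 ltn_add2l expn_gt0.
  by split=> // c; rewrite process_terminal // => -[/l0new].
case: r wl bres {brl} => [|r] wl [|bres] //; try by move/negP: tb.
exists (l0 ++ [seq (child b t, r) | t : {ffun 'I_N -> bool}]); last first.
  apply: leq_trans wl; rewrite /weight big_cat ltn_add2l /=.
  rewrite big_map big_enum /= sum_nat_const card_ffun card_bool card_ord.
  by rewrite expnS ltn_pmul2r ?expn_gt0.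
split=> [c|p].
  rewrite process_split // => -[[/l0new/[apply]][q cq]|[t _ <-]].
    by exists q; rewrite mem_cat cq.
  exists r; rewrite mem_cat; apply/orP; right.
  by apply/mapP; exists t; rewrite // mem_enum.
by rewrite mem_cat => /orP[/l0res//|/mapP[t _ ->]]; exact: bres.
Qed.

Lemma run_halts s l : run f M1 M2 M3 s -> tracks l (s 0%N) ->
  exists t, halted (s t).
Proof.
move=> [_ sstep]; move: {2}(weight l) (leqnn (weight l)) => n.
elim: n 0%N l => [|n IH] t l wl lt; have [|[h _]] := sstep t; try by exists t.
  by move=> /(step_weight lt)[l' _]; rewrite ltnNge (leq_trans wl).
move=> /(step_weight lt)[l' lt' wl']; apply: IH lt'.
by rewrite -ltnS (leq_trans wl').
Qed.

Definition all_boxes (st : @state R N) : set (box R N) :=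
  NewBoxes st `|` (CaseOneBoxes st `|` CaseTwoBoxes st).

Record sound (st : @state R N) : Prop := Sound {
  sound_box : forall b, all_boxes st b ->
    0 <= side b /\ box_set b `<=` cube M1;
  sound_one : forall b, CaseOneBoxes st b -> case_one f M2 b;
  sound_two : forall b, CaseTwoBoxes st b -> case_two f M2 M3 b;
  sound_cover : cube M1 `<=` \bigcup_(b in all_boxes st) box_set b;
  sound_finite : finite_set (CaseOneBoxes st `|` CaseTwoBoxes st) }.

Lemma sound_init : 0 <= M1 -> sound (init M1).
Proof.
move=> M0; split => //=.
- move=> b [->|[]//]; rewrite box_set_init; split => //.
  by rewrite /side /= mulr_ge0.
- move=> x xM; exists (0, 2 * M1); first by left.
  by rewrite box_set_init.
- by rewrite setU0; exact: finite_set0.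
Qed.

Lemma sound_step st st' : sound st -> step f M2 M3 st st' -> sound st'.
Proof.
case: st => new one two [box1 one1 two1 cov1 fin1] [b bnew ->].
have [b0 bM] := box1 b (or_introl bnew).
rewrite /process; case: ifP => [b1|_].
  have same c : all_boxes (State (new `\ b) (one `|` [set b]) two) c <->
      all_boxes (State new one two) c.
    rewrite /all_boxes /=; have [->|cb] := pselect (c = b); tauto.
  split=> /=.
  - by move=> c /same; exact: box1.
  - by move=> c [/one1|->].
  - exact: two1.
  - by move=> x /cov1[c /same cA xc]; exists c.
  - rewrite setUAC finite_setU; split=> //; exact: finite_set1.
case: ifP => [b2|_].
  have same c : all_boxes (State (new `\ b) one (two `|` [set b])) c <->
      all_boxes (State new one two) c.
    rewrite /all_boxes /=; have [->|cb] := pselect (c = b); tauto.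
  split=> /=.
  - by move=> c /same; exact: box1.
  - exact: one1.
  - by move=> c [/two1|->].
  - by move=> x /cov1[c /same cA xc]; exists c.
  - rewrite setUA finite_setU; split=> //; exact: finite_set1.
split=> //=.
- move=> c [[[cn _]|[t _ <-]]|c12].
  + by apply: box1; left.
  + have [c0 cb] := child_box t b0; split=> //; exact: subset_trans cb bM.
  + by apply: box1; right.
- move=> x /cov1[c cA xc]; have [cb|cb] := pselect (c = b).
    move: xc; rewrite cb -bigcup_subdivide => -[d db xd].
    by exists d => //; left; right.
  by exists c => //; case: cA => [cn|c12]; [left; left|right].
Qed.

Lemma run_sound s t : 0 <= M1 -> run f M1 M2 M3 s -> sound (s t).
Proof.
move=> M0 [s0 sstep]; elim: t => [|t IH]; first by rewrite s0; exact: sound_init.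
by case: (sstep t) => [|[_ ->]//]; exact: sound_step.
Qed.

End Termination.

Lemma finite_argmin (R : realType) (T : eqType) (A : set T) (g : T -> R) :
  finite_set A -> A !=set0 -> exists2 a, A a & forall b, A b -> g a <= g b.
Proof.
move=> /finite_seqP[l ->]; elim: l => [[]//|a l IH _].
have [[c cl]|l0] := pselect ([set` l] !=set0).
  have [|d dl dmin] := IH; first by exists c.
  have [ad|da] := leP (g a) (g d).
    exists a => [|b]; rewrite /= inE ?eqxx // => /orP[/eqP->//|/dmin].
    exact: le_trans.
  exists d => [|b]; rewrite /= inE ?dl ?orbT // => /orP[/eqP->|/dmin//].
  exact: ltW.
exists a => [|b]; rewrite /= inE ?eqxx // => /orP[/eqP->//|bl].
by case: l0; exists b.
Qed.

(** * Correctness and termination *)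

Theorem propositionA2 (R : realType) (N k : nat)
    (f : 'I_k -> 'rV[R]_N -> R) (M1 M2 M3 : R)
    (k_gt0 : (0 < k)%N) (M1_ge0 : 0 <= M1)
    (f_smooth : forall i, smooth (f i))
    (zeros_cube : zeros f `<=` cube M1)
    (grad_le : forall i x, cube M1 x -> enorm (gradient (f i) x) <= M2)
    (hess_le : forall i x, cube M1 x -> opnorm2 (hessian (f i) x) <= M3)
    (f_nonsingular : nonsingular f) :
  forall s : nat -> state, run f M1 M2 M3 s ->
  exists t, halted (s t) /\
    exists b0, smallest_box (s t) b0 /\
      let eps := side b0 in
      let B := output (s t) in
      [/\ zeros f `<=` B,
          forall x, B x ->
            `|\det (gram f x)|
              > N%:R * eps * k`!%:R * M2 ^+ (2 * k - 1) * M3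
        & forall x, (cube M1 `\` B) x ->
            maxabs f x > Num.sqrt N%:R * (eps / 2) * M2].
Proof.
move=> s srun.
have M2_ge0 := gradient_bound_ge0 k_gt0 M1_ge0 grad_le.
have M3_ge0 := hessian_bound_ge0 k_gt0 M1_ge0 hess_le.
have [d d_gt0 small] :=
  small_box_terminal M1_ge0 f_smooth M2_ge0 M3_ge0 f_nonsingular.
have [t halt] : exists t, halted (s t).
  (* [2 * M1 / 2 ^ r.+1 < d] because [2 * M1 / d < r.+1 <= 2 ^ r.+1]. *)
  pose r := Num.truncn (2 * M1 / d).
  apply: (@run_halts _ _ _ f M1 M2 M3 s [:: ((0, 2 * M1), r.+1)]) => //.
  rewrite (proj1 srun); split=> [b ->|p]; first by exists r.+1; rewrite inE.
  rewrite inE => /eqP->; apply: (resolvedP small (r := r.+1)).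
  - by rewrite /side /= mulr_ge0.
  - by rewrite box_set_init.
  rewrite /side /= [d * _]mulrC -ltr_pdivrMr //.
  apply: lt_le_trans (truncnS_gt _) _; rewrite -natrX ler_nat.
  exact/ltnW/ltn_expl.
exists t; split=> //.
have [box1 one1 two1 cov1 fin1] := run_sound t M1_ge0 srun.
have {}cov1 x : cube M1 x -> exists2 b,
    (CaseOneBoxes (s t) `|` CaseTwoBoxes (s t)) b & box_set b x.
  by move=> /cov1[b [bnew|b12] xb]; [move: bnew; rewrite halt|exists b].
have [b0 b0C b0_min] : exists2 b0, (CaseOneBoxes (s t) `|` CaseTwoBoxes (s t)) b0
    & forall b, (CaseOneBoxes (s t) `|` CaseTwoBoxes (s t)) b -> side b0 <= side b.
  apply: finite_argmin fin1 _.
  by have [b bC _] := cov1 0 (cube0 M1_ge0); exists b.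
exists b0; split=> // eps B.
have one_box b x : CaseOneBoxes (s t) b -> box_set b x ->
    Num.sqrt N%:R * (eps / 2) * M2 < maxabs f x.
  move=> bC xb; have [bs bM] := box1 b (or_intror (or_introl bC)).
  have := case_one_box k_gt0 M1_ge0 f_smooth grad_le bs bM (one1 b bC) xb.
  apply: le_lt_trans; apply: ler_wpM2r => //; apply: ler_wpM2l.
    exact: sqrtr_ge0.
  by rewrite ler_pM2r ?invr_gt0 //; apply: b0_min; left.
have [eps_ge0 _] := box1 b0 (or_intror b0C).
split.
- move=> x fx; have [b [b1|b2] xb] := cov1 x (zeros_cube x fx); last by exists b.
  have := one_box b x b1 xb; rewrite (proj1 (zeros_maxabs f x) fx) ltNge.
  by rewrite !mulr_ge0 ?sqrtr_ge0 ?divr_ge0.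
- move=> x [b bC xb]; have [bs bM] := box1 b (or_intror (or_intror bC)).
  have := case_two_box k_gt0 M1_ge0 f_smooth grad_le hess_le bs bM (two1 b bC) xb.
  apply: le_lt_trans; do 3 (apply: ler_wpM2r; first by rewrite ?exprn_ge0).
  by apply: ler_wpM2l => //; apply: b0_min; right.
- move=> x [xM xB]; have [b [b1|b2] xb] := cov1 x xM; first exact: one_box b1 xb.
  by case: xB; exists b.
Qed.
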